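(* Every H2GC+FS-algebra can be embedded (by an injective homomorphism of H2GC+FS-algebras) into the complex algebra of its canonical $\mathsf{IK}$-frame.
   Context: An H2GC+FS-algebra is a Heyting algebra $(H,\vee,\wedge,\to,0,1)$ with unary operations $\Diamond,\Box,\dot{\Diamond},\blacksquare$ such that, for all $x,y\in H$: $\Diamond x\le y\iff x\le\blacksquare y$; $\dot{\Diamond} x\le y\iff x\le\Box y$; $\Diamond(x\to y)\le\Box x\to\Diamond y$; and $\Diamond x\to\Box y\le\Box(x\to y)$. Composition of relations: $x\,(R\circ S)\,y$ iff there is $z$ with $x\,R\,z$ and $z\,S\,y$. An $\mathsf{IK}$-frame is a triple $(X,\le,R)$ where $\le$ is a quasiorder on $X$ and $R$ is a binary relation on $X$ with $(R\circ{\le})\subseteq({\le}\circ R)$ and $({\ge}\circ R)\subseteq(R\circ{\ge})$. The canonical frame of an H2GC+FS-algebra on $H$ is $(X(H),\subseteq,R^c)$, where $X(H)$ is the set of all prime lattice filters of $H$ and $F\,R^c\,G\iff\Box^{-1}F\subseteq G\subseteq\Diamond^{-1}F$, with $\Box^{-1}F=\{x\in H\mid\Box x\in F\}$ and $\Diamond^{-1}F=\{x\in H\mid\Diamond x\in F\}$. (It is known that this is an $\mathsf{IK}$-frame.) The complex algebra of an $\mathsf{IK}$-frame $(X,\le,R)$ is $(\mathcal{T}_\le,\cup,\cap,\to^c,\emptyset,X,\Diamond^c,\Box^c,\dot{\Diamond}^c,\blacksquare^c)$, where $\mathcal{T}_\le$ is the set of $\le$-upward closed subsets of $X$; $A\to^c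 B$ is the largest member of $\mathcal{T}_\le$ included in $(X\setminus A)\cup B$; and $\Diamond^cA=\{x\mid\exists y\,(x\,R\,y\ \&\ y\in A)\}$, $\Box^cA=\{x\mid\forall y\,(x\,({\le}\circ R)\,y\Rightarrow y\in A)\}$, $\dot{\Diamond}^cA=\{x\mid\exists y\,(y\,R\,x\ \&\ y\in A)\}$, $\blacksquare^cA=\{x\mid\forall y\,(y\,(R\circ{\ge})\,x\Rightarrow y\in A)\}$. (This is an H2GC+FS-algebra.) *)

(* Defs.v *)
From HB Require Import structures.
From mathcomp Require Import all_boot all_order.
From mathcomp Require Import mathcomp_extra boolp classical_sets.
Set Implicit Arguments.
Unset Strict Implicit.
Unset Printing Implicit Defensive.
Import Order.TTheory.
Local Open Scope order_scope.
Local Open Scope classical_set_scope.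

HB.mixin Record isHeyting (d : Order.disp_t) H of Order.TBLattice d H := {
  himp : H -> H -> H;
  le_himp : forall x y z : H, (z <= himp x y) = (z `&` x <= y)%O }.

#[short(type="heytingType")]
HB.structure Definition Heyting (d : Order.disp_t) :=
  { H of isHeyting d H & Order.TBLattice d H }.

(* [ddia] is the dotted diamond and [bbox] the black box. *)
HB.mixin Record isH2GCFS (d : Order.disp_t) H of Heyting d H := {
  dia : H -> H;
  box : H -> H;
  ddia : H -> H;
  bbox : H -> H;
  dia_bbox : forall x y : H, (dia x <= y) = (x <= bbox y);
  ddia_box : forall x y : H, (ddia x <= y) = (x <= box y);
  dia_himp : forall x y : H, dia (himp x y) <= himp (box x) (dia y);
  himp_box : forall x y : H, himp (dia x) (box y) <= box (himp x y) }.

#[short(type="h2gcfsType")]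
HB.structure Definition H2GCFS (d : Order.disp_t) :=
  { H of isH2GCFS d H & Heyting d H }.

Record h2gcfs_morphism (d d' : Order.disp_t) (H : h2gcfsType d)
    (K : h2gcfsType d') (f : H -> K) : Prop := H2GCFSMorphism {
  h2gcfs_join : {morph f : x y / (x `|` y)%O};
  h2gcfs_meet : {morph f : x y / (x `&` y)%O};
  h2gcfs_himp : {morph f : x y / himp x y};
  h2gcfs_bot : f \bot = \bot;
  h2gcfs_top : f \top = \top;
  h2gcfs_dia : {morph f : x / dia x};
  h2gcfs_box : {morph f : x / box x};
  h2gcfs_ddia : {morph f : x / ddia x};
  h2gcfs_bbox : {morph f : x / bbox x} }.

Section Relations.
Context {T : Type}.
Implicit Types R S : T -> T -> Prop.

(* Composition is read from left to right: first [R], then [S]. *)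
Definition rcomp R S : T -> T -> Prop := fun x y => exists2 z, R x z & S z y.

Definition rconv R : T -> T -> Prop := fun x y => R y x.

Definition rsub R S : Prop := forall x y, R x y -> S x y.

End Relations.

Record ikFrame := IKFrame {
  world :> Type;
  fle : world -> world -> Prop;
  facc : world -> world -> Prop;
  fle_refl : forall x, fle x x;
  fle_trans : forall x y z, fle x y -> fle y z -> fle x z;
  facc_fle : rsub (rcomp facc fle) (rcomp fle facc);
  fge_facc : rsub (rcomp (rconv fle) facc) (rcomp facc (rconv fle)) }.

Arguments fle {_} _ _.
Arguments facc {_} _ _.

Section ComplexAlgebra.
Variable X : ikFrame.
Implicit Types A B C : set X.

Definition up_closed A : Prop := forall x y, fle x y -> A x -> A y.

(* The union of all admissible [C] is the largest one: [cimp_up_closed],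
   [cimp_sub] and [cimp_max] below. *)
Definition cimp A B : set X :=
  \bigcup_(C in [set C | up_closed C /\ C `<=` ~` A `|` B]) C.

Definition cdia A : set X := [set x | exists y, facc x y /\ A y].
Definition cbox A : set X := [set x | forall y, rcomp fle facc x y -> A y].
Definition cddia A : set X := [set x | exists y, facc y x /\ A y].
Definition cbbox A : set X :=
  [set x | forall y, rcomp facc (rconv fle) y x -> A y].

Definition up_closedb : {pred set X} := fun A => `[< up_closed A >].

Record upset := Upset {
  upset_val :> set X;
  upset_valP : upset_val \in up_closedb }.

HB.instance Definition _ := [isSub for upset_val].
HB.instance Definition _ := [Choice of upset by <:].

Lemma up_closedbP A : reflect (up_closed A) (A \in up_closedb).
Proof. exact: asboolP. Qed.

Lemma upsetP (U : upset) : up_closed U.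
Proof. exact/up_closedbP/upset_valP. Qed.

Fact up_closedI : {in up_closedb &, forall A B, (A `&` B)%O \in up_closedb}.
Proof.
move=> A B /up_closedbP uA /up_closedbP uB; apply/up_closedbP => x y xy [Ax Bx].
by split; [exact: uA xy Ax | exact: uB xy Bx].
Qed.

Fact up_closedU : {in up_closedb &, forall A B, (A `|` B)%O \in up_closedb}.
Proof.
move=> A B /up_closedbP uA /up_closedbP uB; apply/up_closedbP => x y xy [Ax|Bx].
  by left; exact: uA xy Ax.
by right; exact: uB xy Bx.
Qed.

Fact up_closed0 : \bot \in up_closedb.
Proof. by apply/up_closedbP. Qed.

Fact up_closedT : \top \in up_closedb.
Proof. by apply/up_closedbP. Qed.

(* Union, intersection, the empty set and the full set, inherited from
   [set X]; the order is inclusion. *)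
HB.instance Definition _ := Order.SubChoice_isTBSubLattice.Build
  set_display (set X) up_closedb set_display upset
  up_closedI up_closedU up_closed0 up_closedT.

Lemma upset_leP (U V : upset) : reflect (U `<=` V) (U <= V).
Proof. exact: subsetPset. Qed.

Lemma upset_joinE (U V : upset) : upset_val (U `|` V)%O = U `|` V.
Proof. by []. Qed.

Lemma upset_meetE (U V : upset) : upset_val (U `&` V)%O = U `&` V.
Proof. by []. Qed.

Lemma upset_botE : upset_val \bot = set0.
Proof. by []. Qed.

Lemma upset_topE : upset_val \top = setT.
Proof. by []. Qed.

Fact cimp_up_closed A B : up_closed (cimp A B).
Proof.
by move=> x y xy [C [uC CAB] Cx]; exists C => //; exact: uC xy Cx.
Qed.

Fact cimp_sub A B : cimp A B `<=` ~` A `|` B.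
Proof. by move=> x [C [_ CAB]]; exact: CAB. Qed.

Fact cimp_max A B C : up_closed C -> C `<=` ~` A `|` B -> C `<=` cimp A B.
Proof. by move=> uC CAB x Cx; exists C. Qed.

Fact cdia_up_closed A : up_closed A -> up_closed (cdia A).
Proof.
move=> uA x x' xx' [y [xy Ay]].
have [|y' x'y' yy'] := @fge_facc X x' y; first by exists x.
by exists y'; split=> //; exact: uA yy' Ay.
Qed.

Fact cbox_up_closed A : up_closed (cbox A).
Proof.
move=> x x' xx' bx y [z x'z zy]; apply: bx.
by exists z => //; exact: fle_trans x'z.
Qed.

Fact cddia_up_closed A : up_closed A -> up_closed (cddia A).
Proof.
move=> uA x x' xx' [y [yx Ay]].
have [|y' yy' y'x'] := @facc_fle X y x'; first by exists x.
by exists y'; split=> //; exact: uA yy' Ay.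
Qed.

Fact cbbox_up_closed A : up_closed (cbbox A).
Proof.
move=> x x' xx' bx y [z yz x'z]; apply: bx.
by exists z => //; exact: fle_trans x'z.
Qed.

Definition upset_of A (uA : up_closed A) : upset :=
  Upset (introT (up_closedbP A) uA).

Definition uimp (U V : upset) := upset_of (@cimp_up_closed U V).
Definition udia (U : upset) := upset_of (cdia_up_closed (@upsetP U)).
Definition ubox (U : upset) := upset_of (@cbox_up_closed U).
Definition uddia (U : upset) := upset_of (cddia_up_closed (@upsetP U)).
Definition ubbox (U : upset) := upset_of (@cbbox_up_closed U).

Fact uimpP (U V W : upset) : (W <= uimp U V) = (W `&` U <= V)%O.
Proof.
apply/upset_leP/upset_leP => [WUV x [/WUV/cimp_sub[|]//]|WUV].
apply: cimp_max; first exact: upsetP.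
move=> x Wx; have [Ux|nUx] := pselect (upset_val U x); last by left.
by right; apply: WUV.
Qed.

HB.instance Definition _ := isHeyting.Build set_display upset uimpP.

Lemma cimpE (U V : upset) x :
  upset_val (himp U V) x <-> forall y, fle x y -> upset_val U y -> upset_val V y.
Proof.
split=> [UVx y xy Uy|UVx].
  by case: (cimp_sub (cimp_up_closed xy UVx)).
exists [set x | forall y, fle x y -> upset_val U y -> upset_val V y] => //; split.
  by move=> a b ab aUV c bc; apply: aUV; exact: fle_trans bc.
move=> a aUV; have [Ua|nUa] := pselect (upset_val U a); last by left.
by right; apply: aUV Ua; exact: fle_refl.
Qed.

Fact udia_ubbox (U V : upset) : (udia U <= V) = (U <= ubbox V).
Proof.
apply/upset_leP/upset_leP => UV x.
  move=> Ux y [z yz xz]; apply: UV; exists z; split=> //.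
  exact: upsetP xz Ux.
by move=> [y [xy /UV]]; apply; exists y => //; exact: fle_refl.
Qed.

Fact uddia_ubox (U V : upset) : (uddia U <= V) = (U <= ubox V).
Proof.
apply/upset_leP/upset_leP => UV x.
  move=> Ux y [z xz zy]; apply: UV; exists z; split=> //.
  exact: upsetP xz Ux.
by move=> [y [yx /UV]]; apply; exists y => //; exact: fle_refl.
Qed.

Fact udia_uimp (U V : upset) : udia (himp U V) <= himp (ubox U) (udia V).
Proof.
apply/upset_leP => x [y [xy UVy]]; apply/cimpE => x' xx' bUx'.
have [|y' x'y' yy'] := @fge_facc X x' y; first by exists x.
exists y'; split=> //; move/cimpE : UVy; apply=> //.
by apply: bUx'; exists x' => //; exact: fle_refl.
Qed.

Fact uimp_ubox (U V : upset) : himp (udia U) (ubox V) <= ubox (himp U V).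
Proof.
apply/upset_leP => x /cimpE UVx v [u xu uv]; apply/cimpE => w vw Uw.
have [|u' uu' u'w] := @facc_fle X u w; first by exists v.
apply: (UVx u'); first exact: fle_trans uu'.
  by exists w.
by exists u' => //; exact: fle_refl.
Qed.

HB.instance Definition _ := isH2GCFS.Build set_display upset
  udia_ubbox uddia_ubox udia_uimp uimp_ubox.

End ComplexAlgebra.

Definition complex_algebra (X : ikFrame) : h2gcfsType set_display := upset X.

Section PrimeFilters.
Context {d : Order.disp_t} {L : tbLatticeType d}.
Implicit Types F : set L.

Record lattice_filter F : Prop := LatticeFilter {
  filter_neq0 : F !=set0;
  filter_le : forall x y : L, x <= y -> F x -> F y;
  filter_meet : forall x y : L, F x -> F y -> F (x `&` y)%O }.

Record prime_filter F : Prop := PrimeFilter {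
  prime_filter_filter :> lattice_filter F;
  prime_filter_proper : F <> setT;
  prime_filter_join : forall x y : L, F (x `|` y)%O -> F x \/ F y }.

Lemma filter_top F : lattice_filter F -> F \top.
Proof. by move=> fF; have [x Fx] := filter_neq0 fF; exact: filter_le (lex1 x) Fx. Qed.

Lemma prime_filter_bot F : prime_filter F -> ~ F \bot.
Proof.
move=> pF F0; apply: (prime_filter_proper pF); rewrite -subTset => x _.
exact: (filter_le pF) F0.
Qed.

End PrimeFilters.

Section PrimeFilterTheorem.
Context {d : Order.disp_t} {H : heytingType d}.
Implicit Types F I : set H.

Definition filter_adjoin F (a : H) : set H :=
  [set z | exists2 m, F m & (m `&` a <= z)%O].

Lemma filter_adjoin_filter F a :
  lattice_filter F -> lattice_filter (filter_adjoin F a).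
Proof.
move=> fF; split.
- by exists \top, \top; [exact: filter_top|exact: lex1].
- by move=> x y xy [m Fm mx]; exists m => //; exact: le_trans xy.
- move=> x y [m Fm mx] [n Fn ny]; exists (m `&` n)%O; first exact: filter_meet.
  rewrite lexI (le_trans _ mx) ?(le_trans _ ny) //.
    by rewrite leI2 // leIr.
  by rewrite leI2 // leIl.
Qed.

Lemma heyting_distr (k x y : H) :
  (k `&` (x `|` y) <= (k `&` x) `|` (k `&` y))%O.
Proof. by rewrite meetC -le_himp leUx !le_himp ![(_ `&` k)%O]meetC leUl leUr. Qed.

Lemma prime_filter_theorem F I : lattice_filter F -> I \bot ->
  (forall x y, x <= y -> I y -> I x) ->
  (forall x y, I x -> I y -> I (x `|` y)%O) ->
  (forall x, F x -> ~ I x) ->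
  exists P : set H, [/\ prime_filter P, F `<=` P & forall x, P x -> ~ I x].
Proof.
move=> fF I0 Ile IU FI.
pose Q G := lattice_filter (F `|` G) /\ (forall x, (F `|` G) x -> ~ I x).
have chainQ (C : set (set H)) :
    C `<=` Q -> total_on C subset -> Q (\bigcup_(X in C) X).
  move=> CQ Ctot.
  have pair x y : (F `|` \bigcup_(X in C) X) x -> (F `|` \bigcup_(X in C) X) y ->
      (F x /\ F y) \/ exists2 X, C X & (F `|` X) x /\ (F `|` X) y.
    move=> [Fx|[X CX Xx]] [Fy|[Y CY Yy]]; first by left.
    - by right; exists Y => //; split; [left|right].
    - by right; exists X => //; split; [right|left].
    - have [XY|YX] := Ctot _ _ CX CY; right.
        by exists Y => //; split; right=> //; exact: XY.
      by exists X => //; split; right=> //; exact: YX.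
  have sub X : C X -> (F `|` X) `<=` (F `|` \bigcup_(X in C) X).
    by move=> CX x [Fx|Xx]; [left|right; exists X].
  split; first split.
  - by exists \top; left; exact: filter_top.
  - move=> x y xy /[dup] /pair /[apply] -[[Fx _]|[X CX [Xx _]]].
      by left; exact: filter_le xy Fx.
    by apply: (sub X) => //; exact: (filter_le (CQ _ CX).1) Xx.
  - move=> x y /pair /[apply] -[[Fx Fy]|[X CX [Xx Xy]]].
      by left; exact: filter_meet.
    by apply: (sub X) => //; exact: (filter_meet (CQ _ CX).1).
  - move=> x /[dup] /pair /[apply] -[[Fx _]|[X CX [Xx _]]]; first exact: FI.
    exact: (CQ _ CX).2.
have [A [[fM MI] Amax]] := Zorn_bigcup chainQ.
set M := F `|` A in fM MI.
have Mmax G : lattice_filter G -> M `<=` G -> (forall x, G x -> ~ I x) -> G `<=` M.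
  move=> fG MG GI; apply: contrapT => nGM.
  have FG : F `|` G = G by apply/setUidPr => x Fx; apply: MG; left.
  apply: (Amax G); last by rewrite /Q FG.
  split; first by move=> x Ax; apply: MG; right.
  by move=> GA; apply: nGM => x /GA; right.
have adj a : ~ M a -> exists2 m, M m & I (m `&` a)%O.
  move=> nMa; apply: contrapT => h; apply: nMa.
  apply: (Mmax (filter_adjoin M a)); first exact: filter_adjoin_filter.
  - by move=> x Mx; exists x => //; exact: leIl.
  - by move=> x [m Mm mx] Ix; apply: h; exists m => //; exact: Ile Ix.
  - by exists \top; [exact: filter_top|exact: leIr].
exists M; split; [split=> //|by move=> x; left|exact: MI].
- by move=> MT; apply: (MI \bot) => //; rewrite MT.
- move=> x y Mxy; apply: contrapT => /not_orP[/adj[m Mm Im] /adj[n Mn In]].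
  apply: (MI ((m `&` n) `&` (x `|` y))%O).
    by apply: (filter_meet fM) => //; exact: filter_meet.
  apply: (Ile _ _ (heyting_distr _ _ _)); apply: IU.
    by apply: (Ile _ _ _ Im); rewrite leI2 ?leIl.
  by apply: (Ile _ _ _ In); rewrite leI2 ?leIr.
Qed.

End PrimeFilterTheorem.

Section CanonicalFrame.
Context {d : Order.disp_t} (H : h2gcfsType d).

Lemma le_dia (x y : H) : x <= y -> dia x <= dia y.
Proof. by move=> xy; rewrite dia_bbox (le_trans xy) // -dia_bbox. Qed.

Lemma le_box (x y : H) : x <= y -> box x <= box y.
Proof. by move=> xy; rewrite -ddia_box (le_trans _ xy) // ddia_box. Qed.

Lemma diaU (x y : H) : dia (x `|` y)%O = (dia x `|` dia y)%O.
Proof.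
apply/le_anti; rewrite dia_bbox leUx -!dia_bbox leUl leUr /=.
by rewrite leUx !le_dia ?leUl ?leUr.
Qed.

Lemma dia0 : dia (\bot : H) = \bot.
Proof. by apply/le_anti; rewrite le0x andbT dia_bbox le0x. Qed.

Lemma boxI (x y : H) : box (x `&` y)%O = (box x `&` box y)%O.
Proof.
apply/le_anti; rewrite lexI !le_box ?leIl ?leIr //=.
by rewrite -ddia_box lexI !ddia_box leIl leIr.
Qed.

Lemma box1 : box (\top : H) = \top.
Proof. by apply/le_anti; rewrite lex1 -ddia_box lex1. Qed.

Definition prime_filters : Type := {F : set H | prime_filter F}.

Definition canonical_le (F G : prime_filters) : Prop := sval F `<=` sval G.

Definition canonical_rel (F G : prime_filters) : Prop :=
  box @^-1` sval F `<=` sval G /\ sval G `<=` dia @^-1` sval F.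

Fact canonical_le_refl F : canonical_le F F.
Proof. by []. Qed.

Fact canonical_le_trans F G K :
  canonical_le F G -> canonical_le G K -> canonical_le F K.
Proof. exact: subset_trans. Qed.

Fact canonical_rel_le :
  rsub (rcomp canonical_rel canonical_le) (rcomp canonical_le canonical_rel).
Proof.
move=> [F pF] [K pK] [[G pG] [/= bFG GdF] /= GK].
rewrite /canonical_le /= in GK.
have fF : lattice_filter F by exact: pF.
have fK : lattice_filter K by exact: pK.
pose E := [set z | exists f g, [/\ F f, K g & (f `&` dia g <= z)%O]].
pose I := [set z | exists2 a, ~ K a & z <= box a].
have fE : lattice_filter E.
  split.
  - exists \top, \top, \top; split; [exact: filter_top|exact: filter_top|].
    exact: lex1.
  - move=> x y xy [f [g [Ff Kg fgx]]]; exists f, g; split=> //.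
    exact: le_trans xy.
  - move=> x y [f [g [Ff Kg fgx]]] [f' [g' [Ff' Kg' fgy]]].
    exists (f `&` f')%O, (g `&` g')%O; split; [exact: filter_meet|exact: filter_meet|].
    rewrite lexI (le_trans _ fgx) ?(le_trans _ fgy) // leI2 ?leIr ?leIl //.
      by rewrite le_dia // leIr.
    by rewrite le_dia // leIl.
have [||||P [pP EP PI]] := @prime_filter_theorem _ H E I fE.
- by exists \bot; [exact: prime_filter_bot|exact: le0x].
- by move=> x y xy [a Ka ya]; exists a => //; exact: le_trans ya.
- move=> x y [a Ka xa] [b Kb yb]; exists (a `|` b)%O.
    by move=> /(prime_filter_join pK)[].
  by rewrite leUx (le_trans xa) ?(le_trans yb) ?le_box ?leUl ?leUr.
- move=> x [f [g [Ff Kg fgx]]] [a Ka xa]; apply: Ka.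
  have Kga : K (himp g a).
    apply/GK/bFG/(filter_le pF _ Ff); apply: le_trans (himp_box g a).
    by rewrite le_himp (le_trans fgx).
  apply: filter_le (filter_meet pK Kga Kg) => //.
  by rewrite -le_himp.
exists (exist _ P pP).
  move=> x Fx; apply: EP; exists x, \top; split=> //; last exact: leIl.
  exact: filter_top.
split=> x /= Px.
  apply: contrapT => Kx; apply: (PI _ Px); exists x => //.
by apply: EP; exists \top, x; split=> //; [exact: filter_top|exact: leIr].
Qed.

Fact canonical_ge_rel :
  rsub (rcomp (rconv canonical_le) canonical_rel)
       (rcomp canonical_rel (rconv canonical_le)).
Proof.
move=> [F pF] [G pG] [[F0 pF0] F0F [/= bFG GdF]].
rewrite /rconv /canonical_le /= in F0F.
have fF : lattice_filter F by exact: pF.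
have fG : lattice_filter G by exact: pG.
pose E := [set z | exists b g, [/\ F (box b), G g & (g `&` b <= z)%O]].
pose I := [set z | ~ F (dia z)].
have fE : lattice_filter E.
  split.
  - exists \top, \top, \top; split; [|exact: filter_top|exact: lex1].
    by rewrite box1; exact: filter_top.
  - move=> x y xy [b [g [Fb Gg bgx]]]; exists b, g; split=> //.
    exact: le_trans xy.
  - move=> x y [b [g [Fb Gg bgx]]] [b' [g' [Fb' Gg' bgy]]].
    exists (b `&` b')%O, (g `&` g')%O; split; [|exact: filter_meet|].
      by rewrite boxI; exact: filter_meet.
    by rewrite lexI (le_trans _ bgx) ?(le_trans _ bgy) // leI2 ?leIr ?leIl.
have [||||P [pP EP PI]] := @prime_filter_theorem _ H E I fE.
- by rewrite /I /= dia0; exact: prime_filter_bot.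
- by move=> x y xy + Fx; apply; exact: filter_le (le_dia xy) Fx.
- by move=> x y nx ny; rewrite /I /= diaU => /(prime_filter_join pF)[].
- move=> x [b [g [Fb Gg bgx]]]; apply.
  have Fi : F (himp (box b) (dia x)).
    apply: (filter_le pF (dia_himp b x)); apply/F0F/GdF/(filter_le pG _ Gg).
    by rewrite le_himp.
  apply: filter_le (filter_meet pF Fi Fb) => //.
  by rewrite -le_himp.
exists (exist _ P pP).
  split=> x /= Px; last by apply: contrapT => nx; apply: (PI _ Px).
  by apply: EP; exists x, \top; split=> //; [exact: filter_top|exact: leIr].
move=> x /= Gx; apply: EP; exists \top, x; split=> //; last exact: leIl.
by rewrite box1; exact: filter_top.
Qed.

Definition canonical_frame : ikFrame :=
  IKFrame canonical_le_refl canonical_le_trans canonical_rel_le canonical_ge_rel.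

End CanonicalFrame.

(* Main.v *)
Require Import Defs.
From mathcomp Require Import all_boot all_order.
From mathcomp Require Import boolp classical_sets.

(** The embedding is the Stone map sending [x] to the set of prime filters that
    contain [x]. By the prime filter theorem it is injective and commutes with
    the lattice operations and with implication, as for every Heyting algebra.

    For the modal operations, one inclusion always follows from the definition
    of the canonical relation [R], using for the two dotted or black operations
    the units [x <= box (ddia x)] and [dia (bbox x) <= x] of the adjunctions.
    The other inclusion asks for a prime filter related to a given one, and two
    existence lemmas provide it, one for each connecting axiom:
    - [canonical_succ], by [dia_himp]: a filter [G] with [dia G] inside a
      prime [F] extends to a prime [P] with [F R P];
    - [canonical_pred], by [himp_box]: a filter [F] whose box-preimage lies in
      a prime [K] extends to a prime [P] with [P R K].
    For [dia] the first lemma is applied to the principal filter of [x], and for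
    [ddia] the second one is. For [box] and [bbox], whose complex versions
    quantify over a composition of [R] with inclusion, a refuting prime filter is
    first found at the far end by separation, then linked to the given one by the
    second, respectively the first, lemma. *)

Set Implicit Arguments.
Unset Strict Implicit.
Unset Printing Implicit Defensive.
Import Order.TTheory.
Local Open Scope order_scope.
Local Open Scope classical_set_scope.

(** * Filters *)

Lemma principal_filter (d : Order.disp_t) (L : tbLatticeType d) (a : L) :
  lattice_filter [set z : L | a <= z].
Proof.
split; first by exists a => /=.
- by move=> x y xy /= ax; exact: le_trans xy.
- by move=> x y /= ax ay; rewrite lexI ax.
Qed.

Lemma prime_filter_separation (d : Order.disp_t) (H : heytingType d)
    (F : set H) (a : H) :
  lattice_filter F -> ~ F a ->
  exists P : set H, [/\ prime_filter P, F `<=` P & ~ P a].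
Proof.
move=> fF Fa.
have [||||P [pP FP PI]] := @prime_filter_theorem _ H F [set z | z <= a] fF.
- exact: le0x.
- by move=> x y xy /= ya; exact: le_trans ya.
- by move=> x y /= xa ya; rewrite leUx xa.
- by move=> x Fx /= xa; apply: Fa; exact: filter_le Fx.
- by exists P; split=> // Pa; exact: PI Pa (lexx a).
Qed.

Lemma filter_himp (d : Order.disp_t) (H : heytingType d) (F : set H) (x y : H) :
  lattice_filter F -> F (himp x y) -> F x -> F y.
Proof.
move=> fF Fxy Fx; apply: (filter_le fF _ (filter_meet fF Fxy Fx)).
by rewrite -le_himp.
Qed.

(** * Existence of related prime filters *)

Section Existence.
Context {d : Order.disp_t} {H : h2gcfsType d}.
Implicit Types F G K : set H.

Lemma box_preim_filter F : lattice_filter F -> lattice_filter (box @^-1` F).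
Proof.
move=> fF; split.
- by exists \top; rewrite /preimage /= box1; exact: filter_top.
- by move=> x y xy /= Fx; exact: filter_le (le_box xy) Fx.
- by move=> x y /= Fx Fy; rewrite /preimage /= boxI; exact: filter_meet.
Qed.

Lemma dia_image_filter F :
  lattice_filter F -> lattice_filter [set z | exists2 m, F m & dia m <= z].
Proof.
move=> fF; split.
- by exists \top, \top; [exact: filter_top|exact: lex1].
- by move=> x y xy [m Fm mx]; exists m => //; exact: le_trans xy.
- move=> x y [m Fm mx] [n Fn ny]; exists (m `&` n)%O; first exact: filter_meet.
  by rewrite lexI (le_trans _ mx) ?(le_trans _ ny) ?le_dia ?leIl ?leIr.
Qed.

(** [P] separates the filter generated by [box @^-1` F] and [G] from the ideal
    of those [z] with [dia z] outside [F]. The two are disjoint: if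
    [g `&` b <= z] then [dia g <= dia (himp b z) <= himp (box b) (dia z)], so
    [dia g] and [box b] in [F] would put [dia z] in [F]. *)
Lemma canonical_succ F G (pF : prime_filter F) :
  lattice_filter G -> G `<=` dia @^-1` F ->
  exists P : prime_filters H,
    canonical_rel (exist _ F pF) P /\ G `<=` sval P.
Proof.
move=> fG GdF; have fF : lattice_filter F by exact: pF.
pose E := [set z | exists b g, [/\ F (box b), G g & (g `&` b <= z)%O]].
pose I := [set z | ~ F (dia z)].
have fE : lattice_filter E.
  have fB := box_preim_filter fF.
  split.
  - exists \top, \top, \top.
    by split; [exact: (filter_top fB)|exact: filter_top|exact: lex1].
  - move=> x y xy [b [g [Fb Gg bgx]]]; exists b, g; split=> //.
    exact: le_trans xy.
  - move=> x y [b [g [Fb Gg bgx]]] [b' [g' [Fb' Gg' bgy]]].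
    exists (b `&` b')%O, (g `&` g')%O.
    split; [exact: (filter_meet fB)|exact: filter_meet|].
    by rewrite lexI (le_trans _ bgx) ?(le_trans _ bgy) // leI2 ?leIr ?leIl.
have [||||P [pP EP PI]] := @prime_filter_theorem _ H E I fE.
- by rewrite /I /= dia0; exact: prime_filter_bot.
- by move=> x y xy + Fx; apply; exact: filter_le (le_dia xy) Fx.
- by move=> x y nx ny; rewrite /I /= diaU => /(prime_filter_join pF)[].
- move=> z [b [g [Fb Gg gbz]]]; apply.
  apply: (filter_himp fF _ Fb); apply: (filter_le fF (dia_himp b z)).
  by apply/GdF/(filter_le fG _ Gg); rewrite le_himp.
exists (exist _ P pP); split; first split=> x /= Px.
- apply: EP; exists x, \top; split=> //; [exact: filter_top|exact: leIr].
- by apply: contrapT => nx; exact: PI Px nx.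
- move=> x Gx; apply: EP; exists \top, x; split=> //; last exact: leIl.
  by rewrite box1; exact: filter_top.
Qed.

(** [P] separates the filter generated by [F] and [dia @` K] from the ideal
    generated by the [box a] with [a] outside [K]. The two are disjoint: if
    [f `&` dia g <= box a] then [f <= himp (dia g) (box a) <= box (himp g a)],
    so [himp g a], and with it [a], would be in [K]. *)
Lemma canonical_pred F K (pK : prime_filter K) :
  lattice_filter F -> box @^-1` F `<=` K ->
  exists P : prime_filters H,
    F `<=` sval P /\ canonical_rel P (exist _ K pK).
Proof.
move=> fF bFK; have fK : lattice_filter K by exact: pK.
pose E := [set z | exists f g, [/\ F f, K g & (f `&` dia g <= z)%O]].
pose I := [set z | exists2 a, ~ K a & z <= box a].
have fE : lattice_filter E.
  split.
  - exists \top, \top, \top.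
    by split; [exact: filter_top|exact: filter_top|exact: lex1].
  - move=> x y xy [f [g [Ff Kg fgx]]]; exists f, g; split=> //.
    exact: le_trans xy.
  - move=> x y [f [g [Ff Kg fgx]]] [f' [g' [Ff' Kg' fgy]]].
    exists (f `&` f')%O, (g `&` g')%O.
    split; [exact: filter_meet|exact: filter_meet|].
    rewrite lexI (le_trans _ fgx) ?(le_trans _ fgy) //.
      by rewrite leI2 ?le_dia ?leIr.
    by rewrite leI2 ?le_dia ?leIl.
have [||||P [pP EP PI]] := @prime_filter_theorem _ H E I fE.
- by exists \bot; [exact: prime_filter_bot|exact: le0x].
- by move=> x y xy [a Ka ya]; exists a => //; exact: le_trans ya.
- move=> x y [a Ka xa] [b Kb yb]; exists (a `|` b)%O.
    by move=> /(prime_filter_join pK)[].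
  by rewrite leUx (le_trans xa) ?(le_trans yb) ?le_box ?leUl ?leUr.
- move=> z [f [g [Ff Kg fgz]]] [a Ka za]; apply: Ka.
  apply: (filter_himp fK _ Kg); apply/bFK/(filter_le fF _ Ff).
  by apply: le_trans (himp_box g a); rewrite le_himp (le_trans fgz).
exists (exist _ P pP); split; last split=> x /= Px.
- move=> x Fx; apply: EP; exists x, \top; split=> //; last exact: leIl.
  exact: filter_top.
- by apply: contrapT => Kx; apply: (PI _ Px); exists x.
- by apply: EP; exists \top, x; split=> //; [exact: filter_top|exact: leIr].
Qed.

End Existence.

(** * The Stone map *)

Section StoneMap.
Context {d : Order.disp_t} (H : h2gcfsType d).
Local Notation X := (canonical_frame H).

Lemma stone_up_closed (x : H) :
  @up_closed X [set F : prime_filters H | sval F x].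
Proof. by move=> F G /= FG Fx; exact: FG. Qed.

Definition stone (x : H) : complex_algebra X := upset_of (@stone_up_closed x).

Lemma upset_ext (U V : upset X) :
  (forall F, upset_val U F <-> upset_val V F) -> U = V.
Proof. by move=> UV; apply: val_inj; apply/predeqP. Qed.

Lemma stone_inj : injective stone.
Proof.
suff le_stone x y : stone x = stone y -> x <= y.
  by move=> x y xy; apply/le_anti; rewrite !le_stone.
move=> xy; apply: contrapT => nxy.
have [P [pP xP Py]] := prime_filter_separation (principal_filter x) nxy.
apply: Py; have : upset_val (stone x) (exist _ P pP) by apply: xP; exact: lexx.
by rewrite xy.
Qed.

Lemma stone_join : {morph stone : x y / (x `|` y)%O}.
Proof.
move=> x y; apply: upset_ext => -[F pF]; rewrite upset_joinE /=.
split; first exact: (prime_filter_join pF).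
by move=> [Fx|Fy]; [exact: (filter_le pF (leUl x y) Fx)
                   |exact: (filter_le pF (leUr y x) Fy)].
Qed.

Lemma stone_meet : {morph stone : x y / (x `&` y)%O}.
Proof.
move=> x y; apply: upset_ext => -[F pF]; rewrite upset_meetE /=.
split=> [Fxy|[Fx Fy]]; last exact: (filter_meet pF).
by split; [exact: (filter_le pF (leIl x y) Fxy)
          |exact: (filter_le pF (leIr y x) Fxy)].
Qed.

Lemma stone_himp : {morph stone : x y / himp x y}.
Proof.
move=> x y; apply: upset_ext => -[F pF]; split.
  move=> Fxy; apply/(@cimpE X) => -[G pG] FG Gx.
  exact: (filter_himp pG (FG _ Fxy) Gx).
move=> /(@cimpE X) Fxy; apply: contrapT => /= nFxy.
(* [y] is outside the filter generated by [F] and [x], by residuation. *)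
have [|P [pP FP Py]] := @prime_filter_separation _ _ (filter_adjoin F x) y
    (filter_adjoin_filter x pF).
  by move=> [m Fm mxy]; apply: nFxy; apply: (filter_le pF _ Fm); rewrite le_himp.
apply: Py; apply: (Fxy (exist _ P pP)).
  by move=> z /= Fz; apply: FP; exists z => //; exact: leIl.
by apply: FP; exists \top; [exact: (filter_top pF)|exact: leIr].
Qed.

Lemma stone_bot : stone \bot = \bot.
Proof.
apply: upset_ext => -[F pF]; rewrite upset_botE.
by split=> // /(prime_filter_bot pF).
Qed.

Lemma stone_top : stone \top = \top.
Proof.
apply: upset_ext => -[F pF]; rewrite upset_topE.
by split=> // _; exact: (filter_top pF).
Qed.

Lemma stone_dia : {morph stone : x / dia x}.
Proof.
move=> x; apply: upset_ext => -[F pF]; split.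
  move=> /= Fdx.
  have [|P [FP xP]] := canonical_succ pF (principal_filter x).
    by move=> z /= xz; exact: (filter_le pF (le_dia xz) Fdx).
  by exists P; split=> //; apply: xP; exact: lexx.
by move=> [G [[_ GdF] Gx]]; exact: GdF.
Qed.

Lemma stone_box : {morph stone : x / box x}.
Proof.
move=> x; apply: upset_ext => -[F pF]; split.
  by move=> /= Fbx G [F' FF' [bF'G _]]; apply: bF'G; exact: FF'.
move=> Fbx; apply: contrapT => /= nFbx.
have [G [pG bFG Gx]] := prime_filter_separation (box_preim_filter pF) nFbx.
have [P [FP PG]] := canonical_pred pG pF bFG.
by apply: Gx; apply: (Fbx (exist _ G pG)); exists P.
Qed.

Lemma stone_ddia : {morph stone : x / ddia x}.
Proof.
move=> x; apply: upset_ext => -[F pF]; split.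
  move=> /= Fdx.
  have [|P [xP PF]] := canonical_pred pF (principal_filter x).
    (* [x <= box z] means [ddia x <= z]. *)
    by move=> z /=; rewrite /preimage /= -ddia_box => /(filter_le pF); exact.
  by exists P; split=> //; apply: xP; exact: lexx.
move=> [[G pG] [[/= bGF _] Gx]]; apply: bGF.
by apply: (filter_le pG _ Gx); rewrite -ddia_box.
Qed.

Lemma stone_bbox : {morph stone : x / bbox x}.
Proof.
move=> x; apply: upset_ext => -[F pF]; split.
  move=> /= Fbx [G pG] [K [_ KdG] FK].
  by apply: (filter_le pG _ (KdG _ (FK _ Fbx))); rewrite dia_bbox.
move=> Fbx; apply: contrapT => /= nFbx.
(* If [dia m <= x] with [m] in [F], then [m <= bbox x] is in [F]. *)
have [|G [pG dFG Gx]] := @prime_filter_separation _ _ _ x (dia_image_filter pF).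
  by move=> [m Fm]; rewrite dia_bbox => /(filter_le pF)/(_ Fm).
have [|P [GP FP]] := canonical_succ pG pF.
  by move=> z Fz; apply: dFG; exists z.
by apply: Gx; apply: (Fbx (exist _ G pG)); exists P.
Qed.

End StoneMap.

Theorem theorem4p7 (d : Order.disp_t) (H : h2gcfsType d) :
  exists f : H -> complex_algebra (canonical_frame H),
    injective f /\ h2gcfs_morphism f.
Proof.
exists (@stone d H); split; first exact: stone_inj.
split.
- exact: stone_join.
- exact: stone_meet.
- exact: stone_himp.
- exact: stone_bot.
- exact: stone_top.
- exact: stone_dia.
- exact: stone_box.
- exact: stone_ddia.
- exact: stone_bbox.
Qed.
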